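(* Let $G$ be the semidihedral group $SD_{8n}=\langle x,y : x^{4n}=y^2=1,\ yxy=x^{2n-1}\rangle$, where $n\ge 2$. Then the commuting conjugacy class graph $\Gamma(G)$ is not CN-hyperenergetic.
   Context: For a finite non-abelian group $G$, the commuting conjugacy class graph $\Gamma(G)$ is the simple undirected graph whose vertices are the conjugacy classes of the non-central elements of $G$; two distinct vertices $a^G$ and $b^G$ are adjacent if there exist $a'\in a^G$, $b'\in b^G$ with $a'b'=b'a'$. For a finite simple graph $\mathcal{G}$ with vertices $v_1,\dots,v_N$, the common neighbourhood matrix $CN(\mathcal{G})$ is the $N\times N$ matrix whose $(i,j)$ entry is, for $i\ne j$, the number of vertices other than $v_i,v_j$ adjacent to both $v_i$ and $v_j$, and is $0$ for $i=j$. The CN-energy $E_{CN}(\mathcal{G})$ is the sum of the absolute values of the eigenvalues of $CN(\mathcal{G})$, counted with multiplicity. With $K_N$ the complete graph on $N=|V(\mathcal{G})|$ vertices, $\mathcal{G}$ is CN-hyperenergetic if $E_{CN}(\mathcal{G})>E_{CN}(K_N)$. *)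

(* Defs.v *)
From mathcomp Require Import all_boot all_order all_algebra all_fingroup.
From mathcomp Require Import all_solvable all_field.

Set Implicit Arguments.
Unset Strict Implicit.
Unset Printing Implicit Defensive.

Import Order.TTheory GRing.Theory Num.Theory.

Local Open Scope ring_scope.

Record sgraph := SGraph {
  vertex :> finType;
  adj : rel vertex;
  adj_sym : symmetric adj;
  adj_irr : irreflexive adj }.

Definition complete_adj (N : nat) : rel 'I_N := fun i j => i != j.

Lemma complete_adj_sym N : symmetric (@complete_adj N).
Proof. by move=> i j; rewrite /complete_adj eq_sym. Qed.

Lemma complete_adj_irr N : irreflexive (@complete_adj N).
Proof. by move=> i; rewrite /complete_adj eqxx. Qed.

Definition complete_graph (N : nat) : sgraph :=
  SGraph (@complete_adj_sym N) (@complete_adj_irr N).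

Definition common_neighbours (g : sgraph) (u v : g) : {set g} :=
  [set w : g | [&& w != u, w != v, adj w u & adj w v]].

(* The vertices are numbered by [enum_val]. *)
Definition cn_matrix (g : sgraph) : 'M[algC]_#|g| :=
  \matrix_(i, j)
    if i == j then 0 else #|common_neighbours (enum_val i) (enum_val j)|%:R.

(* The roots of the characteristic polynomial, each repeated according to its
   algebraic multiplicity: [char_poly A = \prod_(z <- eigenvalues A) ('X - z%:P)]. *)
Definition eigenvalues (m : nat) (A : 'M[algC]_m) : seq algC :=
  sval (closed_field_poly_normal (char_poly A)).

Definition cn_energy (g : sgraph) : algC :=
  \sum_(z <- eigenvalues (cn_matrix g)) `|z|.

(* Both energies are sums of norms, hence real, so that [<] on [algC] compares
   them as real numbers. *)
Definition cn_hyperenergetic (g : sgraph) : bool :=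
  cn_energy (complete_graph #|g|) < cn_energy g.

Section CommutingConjugacyClassGraph.

Local Open Scope group_scope.

Variables (gT : finGroupType) (G : {group gT}).

Definition noncentral_classes : {set {set gT}} :=
  [set a ^: G | a in G :\: 'Z(G)].

Definition ccc_vertex : finType := {C : {set gT} | C \in noncentral_classes}.

Definition ccc_adj : rel ccc_vertex := fun C D =>
  (C != D) && [exists a in val C, exists b in val D, a * b == b * a].

Lemma ccc_adj_sym : symmetric ccc_adj.
Proof.
move=> C D; rewrite /ccc_adj eq_sym; congr (_ && _).
by apply/exists_inP/exists_inP => -[a aC /exists_inP[b bD /eqP ab]];
  exists b => //; apply/exists_inP; exists a; rewrite // ab.
Qed.

Lemma ccc_adj_irr : irreflexive ccc_adj.
Proof. by move=> C; rewrite /ccc_adj eqxx. Qed.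

Definition ccc_graph : sgraph := SGraph ccc_adj_sym ccc_adj_irr.

End CommutingConjugacyClassGraph.

(* Main.v *)
Require Import Defs.
From mathcomp Require Import all_boot all_order all_algebra all_fingroup.
From mathcomp Require Import all_solvable all_field.
From mathcomp Require Import zify ring.

(** The cyclic subgroup <[x]> is abelian of index at most 2 in G.  In such a
    group the centraliser of every non-central element is abelian
    ([cent1_abelian_index2]), so commutation is transitive on non-central
    elements; conjugating one of two commuting pairs so that the two share an
    element, this passes to conjugacy classes: the commuting conjugacy class
    graph is a disjoint union of complete graphs ([ccc_cluster]).

    No disjoint union of complete graphs is CN-hyperenergetic
    ([cluster_not_cn_hyperenergetic]).  Let N be the number of vertices.  A
    block of size m contributes (m - 2)(J - I) to the common neighbourhood
    matrix, with eigenvalues -(m - 2) and (m - 2)(m - 1).  (For isolated vertices,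
    and for N = 2 below, differences such as m - 2 are truncated at 0.)  If the
    graph is not complete, every block has size at most N - 1, so every
    eigenvalue is at least -(N - 3).  The eigenvalues sum to the trace, which is
    0, so adding 2(N - 3) to each of the N of them bounds the energy by 2N(N - 3).
    On the other side (N - 1)(N - 2) is an eigenvalue for the complete graph, and
    in trace 0 the other eigenvalues contribute at least as much to the energy
    again, whence E(K_N) >= 2(N - 1)(N - 2) >= 2N(N - 3).  A complete graph has
    the energy of K_N and needs no estimate.  So neither the multiplicities of
    the eigenvalues nor the exact sizes of the blocks have to
    be computed. *)

Set Implicit Arguments.
Unset Strict Implicit.
Unset Printing Implicit Defensive.

Import Order.TTheory GRing.Theory Num.Theory.

(** * Energy of a matrix with trace zero *)

Section Spectrum.

Local Open Scope ring_scope.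

Variables (m : nat) (A : 'M[algC]_m).

Lemma char_poly_eigenvalues :
  char_poly A = \prod_(z <- eigenvalues A) ('X - z%:P).
Proof.
rewrite /eigenvalues; case: closed_field_poly_normal => s /= {1}->.
by rewrite (monicP (char_poly_monic A)) scale1r.
Qed.

Lemma mem_eigenvalues z : (z \in eigenvalues A) = eigenvalue A z.
Proof.
by rewrite eigenvalue_root_char char_poly_eigenvalues root_prod_XsubC.
Qed.

Lemma size_eigenvalues : size (eigenvalues A) = m.
Proof.
by apply/succn_inj; rewrite -(size_prod_XsubC _ id) -char_poly_eigenvalues
  size_char_poly.
Qed.

Lemma sum_eigenvalues : \sum_(z <- eigenvalues A) z = \tr A.
Proof.
have [m0|m_gt0] := posnP m.
  have /size0nil -> : size (eigenvalues A) = 0%N by rewrite size_eigenvalues.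
  rewrite big_nil /mxtrace big1 // => i.
  by have := leq_trans (ltn_ord i) (eq_leq m0).
apply: oppr_inj; rewrite -char_poly_trace // char_poly_eigenvalues.
by rewrite -coefPn_prod_XsubC size_eigenvalues // -lt0n.
Qed.

(** The remaining eigenvalues sum to [- z], so their norms add up to at least
    [`|z|]. *)
Lemma eigenvalue_energy_le z :
  \tr A = 0 -> eigenvalue A z ->
  `|z| *+ 2 <= \sum_(t <- eigenvalues A) `|t|.
Proof.
rewrite -sum_eigenvalues -mem_eigenvalues => + zA.
rewrite !(big_rem z zA) /= mulr2n lerD2l => /eqP.
by rewrite addr_eq0 => /eqP zE; rewrite {1}zE normrN ler_norm_sum.
Qed.

(** For real [t >= - c] one has [`|t| <= t + 2 * c], and the terms [t] cancel in
    the sum.  The hypothesis on the eigenvalues also makes them real, since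
    comparability in [algC] means having a real difference. *)
Lemma energy_le (c : nat) :
  \tr A = 0 -> (forall z, eigenvalue A z -> - c%:R <= z) ->
  \sum_(t <- eigenvalues A) `|t| <= (m * c).*2%:R.
Proof.
move=> trA0 geA.
have -> : (m * c).*2%:R = \sum_(t <- eigenvalues A) (t + c.*2%:R) :> algC.
  rewrite big_split /= sum_eigenvalues trA0 add0r big_const_seq count_predT.
  by rewrite size_eigenvalues iter_addr_0 -mulrnA; congr _%:R; lia.
rewrite !big_seq; apply: ler_sum => t; rewrite mem_eigenvalues => /geA tge.
have treal : t \is Num.real.
  by rewrite -[t](subrK (- c%:R)) rpredD ?rpredN ?realn // ger0_real ?subr_ge0.
rewrite real_ler_norml // lerDl ler0n andbT.
rewrite -subr_ge0 (_ : _ - _ = (t + c%:R) *+ 2); last first.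
  by rewrite -addnn natrD; ring.
by rewrite mulrn_wge0 // -[c%:R]opprK subr_ge0.
Qed.

End Spectrum.

(** * Disjoint unions of complete graphs *)

Section Cluster.

Local Open Scope ring_scope.

(** The common neighbourhood matrix of the complete graph, in a form that depends
    on the number of vertices only: [complete_graph #|g|] has [#|'I_#|g| |]
    vertices, a number equal but not convertible to [#|g|]. *)
Definition clique_matrix (m : nat) : 'M[algC]_m :=
  \matrix_(i, j) if i == j then 0 else m.-2%:R.

Lemma cn_matrix_complete (g : sgraph) :
  (forall u v : g, u != v -> adj u v) -> cn_matrix g = clique_matrix #|g|.
Proof.
move=> gK; apply/matrixP => i j; rewrite !mxE; case: eqVneq => // ij.
have uv : enum_val i != enum_val j by rewrite (inj_eq enum_val_inj).
have -> : common_neighbours (enum_val i) (enum_val j) =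
    [set: g] :\ enum_val i :\ enum_val j.
  apply/setP => w; rewrite !inE andbT andbCA.
  by case: eqVneq => // wi; case: eqVneq => // wj; rewrite !gK // eq_sym.
congr _%:R; have := cardsD1 (enum_val i) [set: g].
have := cardsD1 (enum_val j) ([set: g] :\ enum_val i).
rewrite !inE eq_sym uv /= cardsT.
by move=> cardj cardi; rewrite [in RHS]cardi cardj.
Qed.

Lemma cn_energy_complete (N : nat) :
  cn_energy (complete_graph N) =
  \sum_(z <- eigenvalues (clique_matrix N)) `|z|.
Proof.
rewrite /cn_energy cn_matrix_complete //.
by rewrite (card_ord N : #|complete_graph N| = N).
Qed.

Lemma cn_matrix_trace (g : sgraph) : \tr (cn_matrix g) = 0.
Proof. by rewrite /mxtrace big1 // => i _; rewrite mxE eqxx. Qed.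

(** The all-ones vector is an eigenvector for (N - 1)(N - 2). *)
Lemma cn_energy_complete_ge (N : nat) :
  (N.-1 * N.-2).*2%:R <= cn_energy (complete_graph N).
Proof.
case: N => [|N]; first by rewrite /cn_energy sumr_ge0.
rewrite cn_energy_complete -muln2 natrM mulr_natr -[X in X *+ _]normr_nat.
apply: eigenvalue_energy_le.
  by rewrite /mxtrace big1 // => i _; rewrite mxE eqxx.
apply/eigenvalueP; exists (const_mx 1); last first.
  by apply/eqP => /rowP /(_ ord0) /eqP; rewrite !mxE oner_eq0.
apply/rowP => j; rewrite !mxE mulr1 (bigD1 j) //= !mxE eqxx mulr0 add0r.
rewrite (eq_bigr (fun=> N.-1%:R)) => [|i ij]; last first.
  by rewrite !mxE (negPf ij) mul1r.
by rewrite sumr_const cardC1 card_ord -mulrnA mulnC.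
Qed.

Variable g : sgraph.

(** Absence of induced paths on three vertices, which characterises disjoint
    unions of complete graphs. *)
Definition cluster_graph :=
  forall u v w : g, adj u v -> adj v w -> u != w -> adj u w.

Definition clique (u : g) : {set g} := [set w | (w == u) || adj u w].

Hypothesis gP : cluster_graph.

Lemma clique_refl u : u \in clique u.
Proof. by rewrite inE eqxx. Qed.

Lemma clique_sym u v : (u \in clique v) = (v \in clique u).
Proof. by rewrite !inE eq_sym adj_sym. Qed.

Lemma clique_sub u v : v \in clique u -> clique v \subset clique u.
Proof.
rewrite inE => /predU1P[-> // | uv]; apply/subsetP => w; rewrite !inE.
case/predU1P=> [-> | vw]; first by rewrite uv orbT.
by case: eqVneq => //= wu; apply: gP uv vw _; rewrite eq_sym.
Qed.

Lemma clique_eq u v : v \in clique u -> clique v = clique u.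
Proof.
by move=> uv; apply/eqP; rewrite eqEsubset !clique_sub // clique_sym.
Qed.

Lemma card_common_neighbours u v : u != v ->
  #|common_neighbours u v| = if v \in clique u then #|clique u|.-2 else 0.
Proof.
move=> uv; case: ifPn => [vu | nvu].
  have -> : common_neighbours u v = clique u :\ u :\ v.
    apply/setP => w; have /setP /(_ w) := clique_eq vu.
    rewrite !inE ![adj w _]adj_sym.
    by case: (w == u) (w == v) (adj u w) (adj v w) => [] [] [] [].
  have := cardsD1 u (clique u); have := cardsD1 v (clique u :\ u).
  rewrite clique_refl in_setD1 vu eq_sym uv /=.
  by move=> cardv cardu; rewrite cardu cardv.
apply/eqP; rewrite cards_eq0; apply/eqP/setP => w; rewrite !inE.
apply: contraNF nvu => /and4P[_ _ wu wv].
by rewrite inE; apply/orP; right; apply: gP _ wv uv; rewrite adj_sym.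
Qed.

(** Let [v] be an eigenvector, [m] the size of the block of [u] and [S] the sum of
    the entries of [v] over it.  The eigenvalue equation at [u] reads
    [(z + (m - 2)) * v_u = (m - 2) * S].  Take [u] with [v_u != 0].  Unless
    [z = - (m - 2)], this gives [S != 0], and summing over the block gives
    [z + (m - 2) = (m - 2) * m].  In a block with [m = 1] the truncated [m.-2] is
    [0], as it should be: an isolated vertex contributes a zero row. *)
Lemma cluster_eigenvalue z : eigenvalue (cn_matrix g) z ->
  exists u, z = - #|clique u|.-2%:R \/ z = (#|clique u|.-2 * #|clique u|.-1)%:R.
Proof.
case/eigenvalueP => v vA v0.
pose f u := v 0 (enum_rank u); pose S u := \sum_(w in clique u) f w.
have fE u : (z + #|clique u|.-2%:R) * f u = #|clique u|.-2%:R * S u.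
  have /rowP/(_ (enum_rank u)) := vA; rewrite !mxE -/(f u) => vAu.
  rewrite mulrDl -vAu (reindex (@enum_rank g)) /=; last exact/onW_bij/enum_rank_bij.
  rewrite /S [in RHS](bigD1 u) ?clique_refl //= mulrDr addrC; congr (_ + _).
  rewrite (bigD1 u) //= mxE eqxx mulr0 add0r big_distrr /=.
  rewrite (eq_bigr (fun w => if w \in clique u then #|clique u|.-2%:R * f w else 0)).
    by rewrite -big_mkcondr /=; apply: eq_bigl => w; rewrite andbC.
  move=> w wu; rewrite mxE (inj_eq enum_rank_inj) (negPf wu) !enum_rankK.
  rewrite card_common_neighbours // [in LHS]clique_sym.
  by case: ifPn => [/clique_eq -> | _]; rewrite ?mulr0 // mulrC.
have [j vj] : exists j, v 0 j != 0.
  apply/existsP; rewrite -negb_forall; apply: contra v0 => /forallP v0.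
  by apply/eqP/rowP => j; rewrite mxE (eqP (v0 j)).
pose u := enum_val j; have fu : f u != 0 by rewrite /f enum_valK.
exists u; have [zu | zu] := eqVneq (z + #|clique u|.-2%:R) 0.
  by left; apply/eqP; rewrite -addr_eq0 zu.
right.
have SE : (z + #|clique u|.-2%:R) * S u = #|clique u|.-2%:R * S u * #|clique u|%:R.
  rewrite {1}/S big_distrr /= mulr_natr -sumr_const; apply: eq_bigr => w wu.
  by rewrite -[in LHS](clique_eq wu) fE /S (clique_eq wu).
have Su : S u != 0.
  apply: contraNneq fu => Su; have /eqP := fE u.
  by rewrite Su mulr0 mulf_eq0 (negPf zu).
have /(mulIf Su) E : (z + #|clique u|.-2%:R) * S u =
  (#|clique u|.-2 * #|clique u|)%:R * S u by rewrite SE natrM; ring.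
have := cardsD1 u (clique u); rewrite clique_refl => cu.
apply: (addIr #|clique u|.-2%:R); rewrite E -natrD; congr _%:R; nia.
Qed.

Theorem cluster_not_cn_hyperenergetic : ~~ cn_hyperenergetic g.
Proof.
rewrite /cn_hyperenergetic.
suff le : cn_energy g <= cn_energy (complete_graph #|g|).
  by apply/negP => /lt_le_trans /(_ le); rewrite ltxx.
(* The complete case is separate because there the least eigenvalue is
   - (N - 2), and [energy_le] only gives 2N(N - 2), which exceeds E(K_N)
   when N > 2. *)
have [/forallP gK | ] := boolP [forall u : g, clique u == [set: g]].
  rewrite cn_energy_complete -cn_matrix_complete // => u v uv.
  by have /setP/(_ v) := eqP (gK u); rewrite !inE eq_sym (negPf uv).
rewrite negb_forall => /existsP[u uK].
have cl w : (#|clique w| < #|g|)%N.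
  rewrite -cardsT; apply: proper_card; rewrite properT.
  apply: contra uK => /eqP wK.
  by rewrite -wK (@clique_eq w u) // wK inE.
apply: le_trans (cn_energy_complete_ge _).
apply: (le_trans (energy_le (c := #|g| - 3) (cn_matrix_trace g) _)).
  move=> z /cluster_eigenvalue[w [] ->]; last first.
    by apply: (@le_trans _ _ 0); rewrite ?oppr_le0 ler0n.
  by rewrite lerN2 ler_nat; have := cl w; lia.
by rewrite ler_nat leq_double; nia.
Qed.

End Cluster.

(** * Groups with an abelian subgroup of index at most two *)

Local Open Scope group_scope.

Section Group.

Variables (gT : finGroupType) (G : {group gT}).

(** Any [c] outside [A] generates [G] together with [A].  If [b] lies in [A], an
    element outside [A] commuting with [b] would make [b] central, so ['C_G[b]] is
    contained in [A].  If not, every element of ['C_G[b]] is a product of an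
    element of ['C_A[b]] and a power of [b], and all of these commute. *)
Lemma cent1_abelian_index2 (A : {group gT}) (b : gT) :
  A \subset G -> abelian A -> #|G : A| <= 2 ->
  b \in G -> b \notin 'Z(G) -> abelian 'C_G[b].
Proof.
move=> sAG abA iAG bG bZ.
have GE c : c \in G -> c \notin A -> G \subset A * <[c]>.
  move=> cG cA; have iAG2 : #|G : A| = 2.
    apply/eqP; rewrite eqn_leq iAG ltn_neqAle indexg_gt0 andbT eq_sym.
    by rewrite indexg_eq1; apply: contra cA => /subsetP ->.
  have cGA : c \in G :\: A by rewrite inE cA.
  apply/subsetP => g gG; have [gA | gA] := boolP (g \in A).
    by rewrite -[g]mulg1 mem_mulg.
  have : g \in A :* c by rewrite (rcoset_index2 sAG iAG2 cGA) inE gA.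
  by case/rcosetP=> a aA ->; rewrite mem_mulg ?cycle_id.
have [bA | bA] := boolP (b \in A).
  apply: (abelianS _ abA); apply/subsetP => c /setIP[cG cb].
  apply: contraR bZ => cA; rewrite inE bG /=.
  apply: (subsetP (centS (GE c cG cA))).
  by rewrite centM inE cent_cycle cent1C cb (subsetP abA).
apply: (@abelianS _ _ (('C_A[b] <*> <[b]>)%G)).
  apply/subsetP => c /setIP[cG cb].
  have /mulsgP[a d aA dB cE] := subsetP (GE b bG bA) c cG.
  have aC : a \in 'C_A[b].
    rewrite inE aA -(groupMr _ (_ : d \in 'C[b])) -?cE //=.
    by apply: subsetP dB; rewrite cycle_subG cent1id.
  by rewrite cE groupM // mem_gen // in_setU ?aC ?dB ?orbT.
rewrite abelianY cycle_abelian (abelianS (subsetIl _ _) abA) /=.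
by rewrite centsC cent_cycle subsetIr.
Qed.

(** If [a] commutes with [b], and a conjugate [b ^ h] commutes with [c], then
    [a ^ h] and [c] both lie in the abelian group ['C_G[b ^ h]]. *)
Lemma ccc_cluster :
  (forall b, b \in G -> b \notin 'Z(G) -> abelian 'C_G[b]) ->
  cluster_graph (ccc_graph G).
Proof.
move=> acG C D E /andP[_ /exists_inP[a aC /exists_inP[b bD /eqP ab]]].
case/andP=> _ /exists_inP[b' b'D /exists_inP[c cE /eqP bc]] CE.
rewrite /= /ccc_adj CE /=.
have class_of (F : ccc_vertex G) x : x \in val F ->
    [/\ x \in G, x \notin 'Z(G) & val F = x ^: G].
  case: F => F /= /imsetP[y /setDP[yG yZ] ->] xy.
  have xG : x \in G by case/imsetP: xy => h hG ->; rewrite groupJ.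
  split; rewrite ?(class_eqP xy) //; case/imsetP: xy => h hG ->.
  by rewrite memJ_norm // (subsetP (normal_norm (center_normal G))).
have [aG _ classC] := class_of _ _ aC; have [_ _ classD] := class_of _ _ bD.
have [b'G b'Z _] := class_of _ _ b'D; have [cG _ _] := class_of _ _ cE.
have /imsetP[h hG bh] : b' \in b ^: G by rewrite -classD.
apply/exists_inP; exists (a ^ h); first by rewrite classC memJ_class.
apply/exists_inP; exists c => //.
have ahC : a ^ h \in 'C_G[b'].
  by rewrite inE groupJ //=; apply/cent1P; rewrite bh /commute -!conjMg ab.
have cC : c \in 'C_G[b'] by rewrite inE cG; apply/cent1P.
by apply/eqP/(centsP (acG _ b'G b'Z)).
Qed.

End Group.

Theorem theorem3p2 (gT : finGroupType) (G : {group gT}) (n : nat)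
    (n_ge2 : (2 <= n)%N)
    (G_SD8n : G \isog Grp (x : y : x ^+ (4 * n) = y ^+ 2 = 1,
                                   y * x * y = x ^+ (2 * n - 1))) :
  ~~ cn_hyperenergetic (ccc_graph G).
Proof.
apply/cluster_not_cn_hyperenergetic/ccc_cluster.
case/existsP: (isoGrp_hom G_SD8n) => -[x y] /= /eqP[defG x4n y2 yxy].
have nAy : y \in 'N(<[x]>).
  (* As y is an involution, the relation says that x ^ y is a power of x. *)
  have yV : y^-1 = y by apply/eqP; rewrite eq_invg_mul -expg2 y2.
  by rewrite -cycle_subG norms_cycle conjgE yV mulgA yxy mem_cycle.
move=> b; apply: (@cent1_abelian_index2 _ _ <[x]>); rewrite ?cycle_abelian //.
  by rewrite -defG joing_subl.
rewrite -divgS -defG ?joing_subl //= norm_joinEr ?cycle_subG //.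
have ord_y : #[y] <= 2 by rewrite dvdn_leq // order_dvdn y2.
apply: leq_trans ord_y; rewrite -[#[y]](mulKn _ (order_gt0 x)).
by rewrite leq_div2r // mul_cardG leq_pmulr // cardG_gt0.
Qed.
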